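(* Let $k,b\in\mathbb{N}$ with $k,b\ge 1$, let $N=kb$, let $\sigma>0$, and let $\mathbf{C}\in\mathbb{R}^{N\times N}$ be a lower-triangular matrix with non-negative entries. For $1\le i\le b$ let $\mathbf{m}_i=\sum_{j=0}^{k-1}|\mathbf{C}|_{:,\,i+jb}\in\mathbb{R}^N$ and let $\mathbf{G}\in\mathbb{R}^{b\times b}$ be the Gram matrix $\mathbf{G}_{i,j}=\langle \mathbf{m}_i,\mathbf{m}_j\rangle$. Let $\hat P=\frac1b\sum_{i=1}^b\mathcal{N}(\mathbf{m}_i,\sigma^2 I_N)$ and $\hat Q=\mathcal{N}(0,\sigma^2 I_N)$. Then for every integer $\alpha\ge 2$, $$R_\alpha(\hat P\,\|\,\hat Q)=\frac{1}{\alpha-1}\log\sum_{(r_1,\dots,r_\alpha)\in\{1,\dots,b\}^\alpha}\exp\Bigg(\sum_{\substack{j_1,j_2=1\\ j_1\neq j_2}}^{\alpha}\frac{\mathbf{G}_{r_{j_1},r_{j_2}}}{2\sigma^2}\Bigg)-\frac{\alpha\log b}{\alpha-1}.$$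
   Context: For probability distributions $P,Q$ with $P\ll Q$ and $\alpha>1$, the Rényi divergence is $R_\alpha(P\|Q)=\frac{1}{\alpha-1}\log\mathbb{E}_{x\sim P}\big[\big(\tfrac{dP}{dQ}(x)\big)^{\alpha-1}\big]$. $|\mathbf{C}|$ is the entrywise absolute value and $|\mathbf{C}|_{:,t}$ its $t$-th column (columns indexed from 1). The inner sum in the exponent runs over ordered pairs $(j_1,j_2)$ with $j_1\ne j_2$. *)

(* Defs.v *)
From HB Require Import structures.
From mathcomp Require Import all_boot all_order all_algebra.
From mathcomp Require Import all_classical all_reals all_analysis.
From mathcomp Require Import measurable_realfun.

Set Implicit Arguments.
Unset Strict Implicit.
Unset Printing Implicit Defensive.

Import Order.TTheory GRing.Theory Num.Theory.
Import numFieldNormedType.Exports.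

Local Open Scope classical_set_scope.
Local Open Scope ring_scope.
Local Open Scope ereal_scope.
Local Open Scope charge_scope.

(* R^n with its Borel (product) sigma-algebra. *)
Notation Rtuple R n := (n.-tuple (measurableTypeR R)).

Section tuple_lebesgue_step.
Context {R : realType} (n : nat).
Variable mu : {sigma_finite_measure set (Rtuple R n) -> \bar R}.

Definition tuple_cons (z : measurableTypeR R * Rtuple R n) : Rtuple R n.+1 :=
  [tuple of z.1 :: z.2].

Lemma measurable_tuple_cons : measurable_fun setT tuple_cons.
Proof. exact: measurable_cons. Qed.

HB.instance Definition _ :=
  isMeasurableFun.Build _ _ _ _ tuple_cons measurable_tuple_cons.

Definition tuple_lebesgue_step : set (Rtuple R n.+1) -> \bar R :=
  pushforward (@lebesgue_measure R \x mu) tuple_cons.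

Let step0 : tuple_lebesgue_step set0 = 0.
Proof. by rewrite /tuple_lebesgue_step /pushforward preimage_set0 measure0. Qed.

Let step_ge0 A : 0 <= tuple_lebesgue_step A.
Proof. exact: measure_ge0. Qed.

Let step_sigma_additive : semi_sigma_additive tuple_lebesgue_step.
Proof. exact: measure_semi_sigma_additive. Qed.

HB.instance Definition _ := isMeasure.Build _ _ _ tuple_lebesgue_step
  step0 step_ge0 step_sigma_additive.

Lemma tuple_lebesgue_step_sigma_finite : sigma_finite setT tuple_lebesgue_step.
Proof.
have /sigma_finiteP[F [TF ndF Foo]] := sigma_finiteT (@lebesgue_measure R).
have /sigma_finiteP[H [TH ndH Hoo]] := sigma_finiteT mu.
pose G i := F i `*` H i.
have GT : setT = \bigcup_i G i.
  rewrite -setXTT TF TH predeqE => -[x y]; split; last first.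
    by move=> [i _ []/= ? ?]; split; exists i.
  move=> [/= [i _ Fix] [j _ Hjy]]; exists (maxn i j) => //; split.
  - by move: x Fix; exact/subsetPset/ndF/leq_maxl.
  - by move: y Hjy; exact/subsetPset/ndH/leq_maxr.
have mG i : measurable (G i) /\ (@lebesgue_measure R \x mu) (G i) < +oo.
  have [? ?] := Foo i; have [? ?] := Hoo i; split; first exact: measurableX.
  by rewrite product_measure1E// lte_mul_pinfty// ge0_fin_numE.
pose uncons (t : Rtuple R n.+1) : measurableTypeR R * Rtuple R n :=
  (tnth t ord0, [tuple of behead t]).
have unconsK z : uncons (tuple_cons z) = z.
  case: z => x t; congr pair => //.
  by apply: val_inj.
exists (fun i => uncons @^-1` G i).
  by rewrite -preimage_bigcup -GT preimage_setT.
move=> i; have [mGi Gioo] := mG i; split.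
  have muncons : measurable_fun setT uncons.
    apply/measurable_fun_pairP; split => /=.
      exact: measurable_tnth.
    exact: measurable_behead.
  by rewrite -[X in measurable X]setTI; exact: muncons.
rewrite /tuple_lebesgue_step /pushforward -comp_preimage.
by rewrite (_ : uncons \o _ = id) //; apply/funext => z /=.
Qed.

HB.instance Definition _ := Measure_isSigmaFinite.Build _ _ _
  tuple_lebesgue_step tuple_lebesgue_step_sigma_finite.

End tuple_lebesgue_step.

(* n-dimensional Lebesgue measure; on R^0 it is the unit mass. *)
Fixpoint tuple_lebesgue (R : realType) (n : nat) :
    {sigma_finite_measure set (Rtuple R n) -> \bar R} :=
  match n with
  | 0%N => \d_([tuple] : Rtuple R 0)
  | n'.+1 => tuple_lebesgue_step (tuple_lebesgue R n')
  end.

Lemma ge0_integral_tuple_lebesgue_prod (R : realType) (n : nat)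
    (f : 'I_n -> measurableTypeR R -> R) :
  (forall i, measurable_fun setT (f i)) -> (forall i x, (0 <= f i x)%R) ->
  \int[tuple_lebesgue R n]_x (\prod_(i < n) f i (tnth x i))%:E =
  \prod_(i < n) \int[@lebesgue_measure R]_x (f i x)%:E.
Proof.
have mprod m (g : 'I_m -> measurableTypeR R -> R) :
    (forall i, measurable_fun setT (g i)) ->
    measurable_fun [set: Rtuple R m]
      (fun x => (\prod_(i < m) g i (tnth x i))%:E).
  move=> mg; apply/measurable_EFinP; apply: measurable_prod => i _.
  by apply: (measurableT_comp (mg i)); exact: measurable_tnth.
elim: n f => [|n IH] f mf f0.
  rewrite big_ord0 /= integral_dirac //; last exact: mprod.
  by rewrite diracT mul1e big_ord0.
rewrite /= ge0_integral_pushforward //=; last 2 first.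
- exact: mprod.
- by move=> x _; rewrite lee_fin prodr_ge0 // => i _.
rewrite fubini_tonelli1 //=; last 2 first.
- exact: (measurableT_comp (mprod _ _ mf) (@measurable_tuple_cons R n)).
- by move=> x; rewrite lee_fin prodr_ge0 // => i _.
rewrite big_ord_recl -(IH (fun i => f (lift ord0 i))) //.
set c := (X in _ = _ * X).
rewrite -ge0_integralZr //=; last 3 first.
- by apply/measurable_EFinP; exact: mf.
- by move=> x _; rewrite lee_fin.
- by apply: integral_ge0 => x _; rewrite lee_fin prodr_ge0 // => i _.
apply: eq_integral => x _; rewrite /fubini_F /= /c -ge0_integralZl //=; last 3 first.
- by apply: (mprod n (fun i => f (lift ord0 i))) => i; exact: mf.
- by move=> y _; rewrite lee_fin prodr_ge0 // => i _.
- by rewrite lee_fin.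
apply: eq_integral => y _; rewrite big_ord_recl EFinM; congr (_ * (_)%:E).
by apply: eq_bigr => i _; congr (f _ _); rewrite /= tnthS.
Qed.

Section gaussian.
Context {R : realType} (n : nat).
Variables (m : 'cV[R]_n) (s : R).

Definition gaussian_pdf (x : Rtuple R n) : R :=
  (Num.sqrt (2 * pi * s ^+ 2) ^- n *
    expR (- (\sum_(i < n) (tnth x i - m i 0) ^+ 2) / (2 * s ^+ 2)))%R.

Lemma gaussian_pdf_ge0 x : (0 <= gaussian_pdf x)%R.
Proof. by rewrite mulr_ge0 ?expR_ge0// invr_ge0 exprn_ge0// sqrtr_ge0. Qed.

Lemma gaussian_pdfE x : s != 0%R ->
  gaussian_pdf x = (\prod_(i < n) normal_pdf (m i 0) s (tnth x i))%R.
Proof.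
move=> s0; under eq_bigr do rewrite normal_pdfE//.
rewrite big_split /= prodr_const card_ord /normal_peak exprVn; congr (_ * _)%R.
  by rewrite -mulrA mulr_natl (mulrC pi).
rewrite /normal_fun -expR_sum; congr expR.
rewrite -mulr_suml -sumrN; congr (_ / _)%R.
by rewrite mulr_natl.
Qed.

Lemma measurable_gaussian_pdf : measurable_fun setT gaussian_pdf.
Proof.
apply: measurable_funM => //; apply: measurableT_comp => //.
apply: measurable_funM => //; apply: measurableT_comp => //.
apply: measurable_sum => i; apply: measurable_funX.
by apply: measurable_funB => //; exact: measurable_tnth.
Qed.

(* N(m, s^2 I_n); the degenerate N(m, 0) is the Dirac mass at m. *)
Definition gaussian_prob (A : set (Rtuple R n)) : \bar R :=
  if s == 0%R then \d_([tuple m i 0%R | i < n] : Rtuple R n) A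
  else \int[tuple_lebesgue R n]_(x in A) (gaussian_pdf x)%:E.

Let gaussian0 : gaussian_prob set0 = 0.
Proof.
by rewrite /gaussian_prob; case: ifP => _; rewrite ?measure0 ?integral_set0.
Qed.

Let gaussian_ge0 A : 0 <= gaussian_prob A.
Proof.
rewrite /gaussian_prob; case: ifP => _; first exact: measure_ge0.
by apply: integral_ge0 => x _; rewrite lee_fin gaussian_pdf_ge0.
Qed.

Let gaussian_sigma_additive : semi_sigma_additive gaussian_prob.
Proof.
rewrite /gaussian_prob; have [_|s0] := eqVneq s 0%R.
  exact: measure_semi_sigma_additive.
move=> F mF tF mUF; rewrite ge0_integral_bigcup//=.
- apply: is_cvg_ereal_nneg_natsum_cond => i _ _.
  by apply: integral_ge0 => x _; rewrite lee_fin gaussian_pdf_ge0.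
- apply/measurable_EFinP; apply: measurable_funTS.
  exact: measurable_gaussian_pdf.
- by move=> x _; rewrite lee_fin gaussian_pdf_ge0.
Qed.

HB.instance Definition _ := isMeasure.Build _ _ _ gaussian_prob
  gaussian0 gaussian_ge0 gaussian_sigma_additive.

Let gaussian_setT : gaussian_prob setT = 1.
Proof.
rewrite /gaussian_prob; have [_|s0] := eqVneq s 0%R; first exact: diracT.
under eq_integral do rewrite gaussian_pdfE//.
rewrite (ge0_integral_tuple_lebesgue_prod
  (f := fun i => normal_pdf (m i 0%R) s)).
- by rewrite big1// => i _; exact: integral_normal_pdf.
- by move=> i; exact: measurable_normal_pdf.
- by move=> i x; exact: normal_pdf_ge0.
Qed.

HB.instance Definition _ :=
  Measure_isProbability.Build _ _ _ gaussian_prob gaussian_setT.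

End gaussian.

Section uniform_mixture.
Context d (T : measurableType d) (R : realType) (b : nat).

Definition uniform_mixture (b_gt0 : (0 < b)%N) (P : 'I_b -> probability T R)
    (A : set T) : \bar R :=
  b%:R^-1%:E * \sum_(i < b) P i A.

Variables (b_gt0 : (0 < b)%N) (P : 'I_b -> probability T R).

Let mixture0 : uniform_mixture b_gt0 P set0 = 0.
Proof. by rewrite /uniform_mixture big1 ?mule0// => i _; rewrite measure0. Qed.

Let mixture_ge0 A : 0 <= uniform_mixture b_gt0 P A.
Proof.
by rewrite mule_ge0 ?lee_fin ?invr_ge0// sume_ge0// => i _; exact: measure_ge0.
Qed.

Let mixture_sigma_additive : semi_sigma_additive (uniform_mixture b_gt0 P).
Proof.
move=> F mF tF mUF.
rewrite [X in _ --> X](_ : _ = \sum_(n <oo) uniform_mixture b_gt0 P (F n)).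
  by apply: is_cvg_ereal_nneg_natsum_cond => n _ _; exact: mixture_ge0.
rewrite /uniform_mixture nneseriesZl; last first.
  by move=> n _; rewrite sume_ge0// => i _; exact: measure_ge0.
congr (_ * _); rewrite nneseries_sum; last first.
  by move=> *; exact: measure_ge0.
by apply: eq_bigr => i _; exact: measure_semi_bigcup.
Qed.

HB.instance Definition _ := isMeasure.Build _ _ _ (uniform_mixture b_gt0 P)
  mixture0 mixture_ge0 mixture_sigma_additive.

Let mixture_setT : uniform_mixture b_gt0 P setT = 1.
Proof.
rewrite /uniform_mixture; under eq_bigr do rewrite probability_setT.
rewrite sumEFin sumr_const card_ord -EFinM mulVf//.
by rewrite pnatr_eq0 -lt0n.
Qed.

HB.instance Definition _ :=
  Measure_isProbability.Build _ _ _ (uniform_mixture b_gt0 P) mixture_setT.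

End uniform_mixture.

(* Only meaningful when P `<< Q: otherwise the Radon-Nikodym derivative of the
   library is constantly -oo, and so is the divergence for alpha > 1. *)
Definition renyi_divergence d (T : measurableType d) (R : realType) (alpha : R)
    (P Q : probability T R) : \bar R :=
  ((alpha - 1)^-1)%:E *
  lne (\int[P]_x (('d (charge_of_finite_measure P) '/d Q) x `^ (alpha - 1))).

Lemma block_index_subproof (k b : nat) (i : 'I_b) (j : 'I_k) :
  (i + j * b < k * b)%N.
Proof.
by rewrite (leq_trans (n := b + j * b)) ?ltn_add2r// -mulSn leq_mul2r ltn_ord orbT.
Qed.

Definition block_index (k b : nat) (i : 'I_b) (j : 'I_k) : 'I_(k * b) :=
  Ordinal (block_index_subproof i j).

(* Main.v *)
(* With h = dP/dQ the average of the Gaussian likelihood ratios l_1, ..., l_b,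
   E_P[h^(alpha-1)] = E_Q[h^alpha]. Expanding the power gives b^-alpha times the
   sum over r of E_Q[prod_j l_(r_j)], and completing the square turns each
   product into a constant times the likelihood ratio of the Gaussian centred
   at sum_j m_(r_j), whose expectation under Q is 1. *)

Require Import Defs.
From mathcomp Require Import all_boot all_order all_algebra.
From mathcomp Require Import all_classical all_reals all_analysis.
From mathcomp Require Import ring measurable_realfun.
Import Order.TTheory GRing.Theory Num.Theory.
Local Open Scope ring_scope.

(** * Measures given by a density, and their Rényi divergence *)

Section density.
Local Open Scope classical_set_scope.
Local Open Scope ereal_scope.
Local Open Scope charge_scope.
Context d (T : measurableType d) (R : realType).
Variables (nu : {finite_measure set T -> \bar R})
          (mu : {sigma_finite_measure set T -> \bar R}) (p : T -> R).
Hypothesis mp : measurable_fun setT p.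
Hypothesis nuE :
  forall A, measurable A -> nu A = \int[mu]_(x in A) (p x)%:E.

Let mEp A : measurable_fun A (EFin \o p).
Proof. exact/measurable_EFinP/measurable_funTS. Qed.

Lemma null_dominates_density : nu `<< mu.
Proof.
apply/null_content_dominatesP => A mA A0.
by rewrite nuE// null_set_integral.
Qed.

(** An integrable function is determined [mu]-a.e. by its integrals over measurable sets, and on
    each such set both sides integrate to [nu A]. *)
Lemma ae_eq_Radon_Nikodym_density :
  ae_eq mu setT ('d (charge_of_finite_measure nu) '/d mu) (EFin \o p).
Proof.
have numu := null_dominates_density.
apply: integral_ae_eq => //; first exact: Radon_Nikodym_integrable.
by move=> A _ mA; rewrite -Radon_Nikodym_integral//= -nuE.
Qed.

(** Change of variables is applied with the derivative [Radon_Nikodym_SigmaFinite.f], which has the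
    same integrals as [p] over measurable sets and may therefore be replaced by [p] almost
    everywhere. *)
Lemma ge0_integral_density (g : T -> \bar R) (A : set T) : measurable A ->
  measurable_fun setT g -> (forall x, 0 <= g x) ->
  \int[nu]_(x in A) g x = \int[mu]_(x in A) (g x * (p x)%:E).
Proof.
move=> mA mg g0; have numu := null_dominates_density.
have mgA := measurable_funTS (D := A) mg.
rewrite -(Radon_Nikodym_SigmaFinite.change_of_variables numu)//.
apply: ae_eq_integral => //.
- apply: emeasurable_funM => //; apply: measurable_funTS.
  exact: measurable_int (Radon_Nikodym_SigmaFinite.f_integrable numu).
- exact: emeasurable_funM.
- apply: ae_eqe_mul2l; apply: integral_ae_eq => //.
  + by apply: integrableS (Radon_Nikodym_SigmaFinite.f_integrable numu).
  + by move=> E _ mE; rewrite -Radon_Nikodym_SigmaFinite.f_integral// nuE.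
Qed.

End density.

(** Frees the divergence from the abstract derivative: once [h] stands for dP/dQ, one factor [h]
    absorbs the passage from [P] to [Q]. *)
Lemma renyi_divergence_density d (T : measurableType d) (R : realType)
    (alpha : R) (P Q : probability T R) (h : T -> R) : 0 < alpha ->
  measurable_fun setT h -> (forall x, 0 <= h x) ->
  (forall A, measurable A -> P A = \int[Q]_(x in A) (h x)%:E)%E ->
  (renyi_divergence alpha P Q =
   ((alpha - 1)^-1)%:E * lne (\int[Q]_x (h x `^ alpha)%:E))%E.
Proof.
move=> alpha_gt0 mh h0 PE; congr (_ * lne _)%E.
have PQ := null_dominates_density _ _ _ _ _ _ mh PE.
have RN := ae_eq_Radon_Nikodym_density _ _ _ _ _ _ mh PE.
have mhA : measurable_fun setT (fun x => (h x `^ (alpha - 1))%:E).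
  apply/measurable_EFinP.
  exact: (measurableT_comp (measurable_powR _)).
transitivity (\int[P]_x (h x `^ (alpha - 1))%:E)%E.
  apply: ae_eq_integral => //.
    apply: (measurableT_comp (measurable_poweR _)).
    by apply: (measurable_int Q); exact: Radon_Nikodym_integrable.
  (* [RN] holds [Q]-a.e., while the integral is against [P]; domination carries the null set
     over. *)
  apply: (null_dominates_ae_eq _ PQ) => //.
  exact: (ae_eq_comp (fun y => poweR y (alpha - 1)) RN).
rewrite (ge0_integral_density _ _ _ _ _ _ mh PE)//; last first.
  by move=> x; rewrite lee_fin powR_ge0.
(* Where [h x = 0] both sides vanish, the right one because [0 < alpha]. *)
by apply: eq_integral => x _; rewrite -EFinM mulrC mulr_powRB1.
Qed.

(** * Likelihood ratios of isotropic Gaussians and their products *)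

Section gaussian_likelihood_ratio.
Context {R : realType} {n : nat}.
Implicit Types (m : 'cV[R]_n) (s : R) (x : Rtuple R n).

(* The density of N(m, s^2 I) with respect to N(0, s^2 I). *)
Definition gaussian_ratio m s x : R :=
  expR ((2 * (\sum_(i < n) tnth x i * m i 0) - (m^T *m m) 0 0) / (2 * s ^+ 2)).

Lemma gaussian_ratio_ge0 m s x : 0 <= gaussian_ratio m s x.
Proof. exact: expR_ge0. Qed.

Lemma measurable_gaussian_ratio m s : measurable_fun setT (gaussian_ratio m s).
Proof.
apply: measurableT_comp => //; apply: measurable_funM => //.
apply: measurable_funB => //; apply: measurable_funM => //.
apply: measurable_sum => i; apply: measurable_funM => //.
exact: measurable_tnth.
Qed.

(** The normalising constants agree, and in each coordinate -(x - m)^2 = (2xm - m^2) - x^2. *)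
Lemma gaussian_pdf_ratio m s x :
  gaussian_pdf m s x = gaussian_ratio m s x * gaussian_pdf 0 s x.
Proof.
rewrite /gaussian_pdf [RHS]mulrCA -expRD -mulrDl; do 2 f_equal; congr (_ * _).
rewrite mxE mulr_sumr -!sumrN -!big_split /=.
by apply: eq_bigr => i _; rewrite !mxE; ring.
Qed.

Lemma gaussian_prob_pdf m s (A : set (Rtuple R n)) : s != 0 ->
  (gaussian_prob m s A =
   \int[tuple_lebesgue R n]_(x in A) (gaussian_pdf m s x)%:E)%E.
Proof. by rewrite /gaussian_prob => /negPf ->. Qed.

Lemma ge0_integral_gaussian_prob m s (g : Rtuple R n -> \bar R)
    (A : set (Rtuple R n)) : s != 0 -> measurable A ->
  measurable_fun setT g -> (forall x, (0 <= g x)%E) ->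
  (\int[gaussian_prob m s]_(x in A) g x =
   \int[tuple_lebesgue R n]_(x in A) (g x * (gaussian_pdf m s x)%:E))%E.
Proof.
move=> s0 mA mg g0; apply: ge0_integral_density => //.
- exact: measurable_gaussian_pdf.
- by move=> B _; exact: gaussian_prob_pdf.
Qed.

Lemma gaussian_prob_ratio m s (A : set (Rtuple R n)) : s != 0 -> measurable A ->
  (gaussian_prob m s A =
   \int[gaussian_prob 0 s]_(x in A) (gaussian_ratio m s x)%:E)%E.
Proof.
move=> s0 mA; rewrite ge0_integral_gaussian_prob//.
- rewrite gaussian_prob_pdf//; apply: eq_integral => x _.
  by rewrite gaussian_pdf_ratio.
- by apply/measurable_EFinP; exact: measurable_gaussian_ratio.
- by move=> x; rewrite lee_fin gaussian_ratio_ge0.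
Qed.

(* Completing the square: |sum_i m_i|^2 - sum_i |m_i|^2 is the sum of the
   off-diagonal inner products. *)
Lemma prod_gaussian_ratio (I : finType) (m : I -> 'cV[R]_n) s x :
  \prod_i gaussian_ratio (m i) s x =
  expR (\sum_i \sum_(j | i != j) ((m i)^T *m m j) 0 0 / (2 * s ^+ 2)) *
  gaussian_ratio (\sum_i m i) s x.
Proof.
rewrite -expR_sum -expRD; congr expR.
under [X in _ = X + _]eq_bigr do rewrite -mulr_suml.
rewrite -!mulr_suml -mulrDl; congr (_ / _).
rewrite sumrB addrCA; congr (_ + _).
  rewrite -mulr_sumr exchange_big/=; congr (_ * _).
  by apply: eq_bigr => i _; rewrite -mulr_sumr summxE.
have -> : (\sum_i m i)^T = \sum_i (m i)^T by exact: linear_sum.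
rewrite mulmx_suml summxE -sumrB -sumrN.
(* For fixed [i], the inner products of [m i] with all [m j], less those with [j != i], leave only
   the squared norm of [m i]. *)
apply: eq_bigr => i _; rewrite mulmx_sumr summxE [X in _ - X](bigD1 i)//=.
under [X in X - _]eq_bigl do rewrite eq_sym.
by rewrite opprD addrCA subrr addr0.
Qed.

Lemma integral_prod_gaussian_ratio (I : finType) (m : I -> 'cV[R]_n) s :
  s != 0 ->
  (\int[gaussian_prob 0 s]_x (\prod_i gaussian_ratio (m i) s x)%:E =
   (expR (\sum_i \sum_(j | i != j) ((m i)^T *m m j) 0 0 / (2 * s ^+ 2)))%:E)%E.
Proof.
move=> s0; under eq_integral do rewrite prod_gaussian_ratio EFinM.
rewrite ge0_integralZl_EFin ?expR_ge0//.
(* The remaining integral is the total mass of the Gaussian centred at [\sum_i m i]. *)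
- by rewrite -gaussian_prob_ratio// probability_setT mule1.
- by move=> x _; rewrite lee_fin gaussian_ratio_ge0.
- by apply/measurable_EFinP; exact: measurable_gaussian_ratio.
Qed.

End gaussian_likelihood_ratio.

(** * Density and moments of the uniform Gaussian mixture *)

Section gaussian_mixture.
Context {R : realType} {n b : nat} (b_gt0 : (0 < b)%N).
Variables (m : 'I_b -> 'cV[R]_n) (s : R).
Hypothesis s0 : s != 0.

Definition mixture_ratio (x : Rtuple R n) : R :=
  b%:R^-1 * \sum_i gaussian_ratio (m i) s x.

Lemma mixture_ratio_ge0 x : 0 <= mixture_ratio x.
Proof.
by rewrite mulr_ge0// sumr_ge0// => i _; exact: gaussian_ratio_ge0.
Qed.

Lemma measurable_mixture_ratio : measurable_fun setT mixture_ratio.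
Proof.
apply: measurable_funM => //; apply: measurable_sum => i.
exact: measurable_gaussian_ratio.
Qed.

Lemma uniform_mixture_ratio (A : set (Rtuple R n)) : measurable A ->
  (uniform_mixture b_gt0 (fun i => gaussian_prob (m i) s) A =
   \int[gaussian_prob 0 s]_(x in A) (mixture_ratio x)%:E)%E.
Proof.
have mr i : measurable_fun A (EFin \o gaussian_ratio (m i) s).
  by apply/measurable_EFinP/measurable_funTS; exact: measurable_gaussian_ratio.
move=> mA; rewrite /uniform_mixture /mixture_ratio.
under [RHS]eq_integral do rewrite EFinM -sumEFin.
rewrite ge0_integralZl_EFin//; last 2 first.
- by move=> x _; apply: sume_ge0 => i _; rewrite lee_fin gaussian_ratio_ge0.
- exact: emeasurable_sum.
rewrite ge0_integral_sum//; last first.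
  by move=> i x _; rewrite lee_fin gaussian_ratio_ge0.
by congr (_ * _)%E; apply: eq_bigr => i _; exact: gaussian_prob_ratio.
Qed.

(** The sum over [r] comes from expanding an [a]-fold product of sums. The condition [j1 != j2]
    compares positions, not values: a centre repeated in [r] still contributes its squared norm. *)
Lemma integral_mixture_ratioX (a : nat) :
  (\int[gaussian_prob 0 s]_x (mixture_ratio x ^+ a)%:E =
   (b%:R^-1 ^+ a * \sum_(r : {ffun 'I_a -> 'I_b})
      expR (\sum_j1 \sum_(j2 | j1 != j2)
        ((m (r j1))^T *m m (r j2)) 0 0 / (2 * s ^+ 2)))%:E)%E.
Proof.
have mr (r : {ffun 'I_a -> 'I_b}) : measurable_fun setT
    (fun x => (\prod_j gaussian_ratio (m (r j)) s x)%:E).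
  apply/measurable_EFinP; apply: measurable_prod => j _.
  exact: measurable_gaussian_ratio.
have r_ge0 (r : {ffun 'I_a -> 'I_b}) x :
    (0 <= (\prod_j gaussian_ratio (m (r j)) s x)%:E)%E.
  by rewrite lee_fin prodr_ge0// => j _; exact: gaussian_ratio_ge0.
transitivity (\int[gaussian_prob 0 s]_x ((b%:R^-1 ^+ a)%:E *
    \sum_(r : {ffun 'I_a -> 'I_b}) (\prod_j gaussian_ratio (m (r j)) s x)%:E))%E.
  apply: eq_integral => x _; rewrite sumEFin -EFinM exprMn; congr (_ * _)%:E.
  (* The power is rewritten as a constant product over ['I_a], so that distributivity yields a sum
     over functions [r]. *)
  by rewrite -[in LHS](card_ord a) -prodr_const bigA_distr_bigA.
rewrite ge0_integralZl_EFin ?exprn_ge0//; last 2 first.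
- by move=> x _; exact: sume_ge0.
- exact: emeasurable_sum.
rewrite ge0_integral_sum// EFinM -sumEFin; congr (_ * _)%E.
by apply: eq_bigr => r _; rewrite integral_prod_gaussian_ratio.
Qed.

End gaussian_mixture.

(** * The closed formula for the divergence *)

Theorem lemma3p2 (R : realType) (k b : nat) (k_gt0 : (0 < k)%N)
    (b_gt0 : (0 < b)%N) (sigma : R) (sigma_gt0 : 0 < sigma)
    (C : 'M[R]_(k * b)) (C_trig : is_trig_mx C)
    (C_ge0 : forall i j, 0 <= C i j)
    (alpha : nat) (alpha_ge2 : (2 <= alpha)%N) :
  let absC : 'M[R]_(k * b) := map_mx (fun x => `|x|) C in
  let m (i : 'I_b) : 'cV[R]_(k * b) :=
    \sum_(j < k) col (block_index i j) absC in
  let G : 'M[R]_b := \matrix_(i, j) ((m i)^T *m m j) 0 0 in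
  let Phat := uniform_mixture b_gt0 (fun i => gaussian_prob (m i) sigma) in
  let Qhat := gaussian_prob (0 : 'cV[R]_(k * b)) sigma in
  renyi_divergence alpha%:R Phat Qhat =
  ((alpha%:R - 1)^-1 *
     ln (\sum_(r : {ffun 'I_alpha -> 'I_b})
           expR (\sum_(j1 < alpha) \sum_(j2 < alpha | j1 != j2)
                   G (r j1) (r j2) / (2 * sigma ^+ 2)))
   - alpha%:R * ln b%:R / (alpha%:R - 1))%:E.
Proof.
move=> absC m G Phat Qhat.
have s0 : sigma != 0 by rewrite gt_eqF.
have alpha_gt0 : 0 < alpha%:R :> R by rewrite ltr0n (leq_trans _ alpha_ge2).
have b0 : 0 < b%:R :> R by rewrite ltr0n.
rewrite (renyi_divergence_density _ _ _ _ _ _ (mixture_ratio m sigma))//;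
  last 3 first.
- exact: measurable_mixture_ratio.
- exact: mixture_ratio_ge0.
- by move=> A; exact: uniform_mixture_ratio.
(* The real power with exponent [alpha%:R] becomes a natural power, which can be expanded. *)
under eq_integral do rewrite powR_mulrn ?mixture_ratio_ge0//.
rewrite integral_mixture_ratioX//.
set S := (X in lne (_ * X)%:E); set S' := (X in ln X).
have -> : S' = S.
  apply: eq_bigr => r _; congr expR; apply: eq_bigr => j1 _.
  by apply: eq_bigr => j2 _; rewrite mxE.
have S_gt0 : 0 < S.
  (* The constant tuple at index 0, available since [0 < b], supplies one strictly positive term;
     positivity of [S] makes the extended logarithm the real one and lets it split over the
     product. *)
  rewrite /S (bigD1 [ffun=> Ordinal b_gt0])//= ltr_pwDl ?expR_gt0//.
  by apply: sumr_ge0 => r _; exact: expR_ge0.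
have bX_gt0 : 0 < b%:R^-1 ^+ alpha :> R by rewrite exprn_gt0// invr_gt0.
rewrite lne_EFin ?mulr_gt0// -EFinM lnM ?posrE// lnXn ?invr_gt0// lnV ?posrE//.
by congr _%:E; rewrite -mulr_natl; ring.
Qed.
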